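(* Every central reduced ring is central semicommutative.
   Context: All rings are associative with identity, not necessarily commutative. A ring $R$ is called central reduced if every nilpotent element of $R$ is central. A ring $R$ is called central semicommutative if for any $a,b\in R$, $ab=0$ implies that $arb$ is a central element of $R$ for each $r\in R$. *)

(* Defs.v *)
From HB Require Import structures.
From mathcomp Require Import all_boot all_algebra.

Set Implicit Arguments.
Unset Strict Implicit.
Unset Printing Implicit Defensive.

Import GRing.Theory.
Local Open Scope ring_scope.

(* [pzRingType] is the structure of arbitrary associative unital rings, the
   zero ring included ([nzRingType] would require 1 != 0). *)

Definition nilpotent_elt (R : pzRingType) (x : R) : Prop :=
  exists2 n : nat, (0 < n)%N & x ^+ n = 0.

Definition central_elt (R : pzRingType) (x : R) : Prop :=
  forall y : R, GRing.comm x y.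

Definition central_reduced (R : pzRingType) : Prop :=
  forall x : R, nilpotent_elt x -> central_elt x.

Definition central_semicommutative (R : pzRingType) : Prop :=
  forall a b : R, a * b = 0 -> forall r : R, central_elt (a * r * b).

(* Main.v *)
Require Import Defs.
From mathcomp Require Import all_boot all_algebra.

(* If a b = 0 then c = b a squares to zero, hence is central; so
   (a r b)^3 = a r c r c r b = a r^2 c^2 r b = 0, and a r b is central. *)

Import GRing.Theory.
Local Open Scope ring_scope.

Theorem proposition2p8 (R : pzRingType) :
  central_reduced R -> central_semicommutative R.
Proof.
move=> cR a b ab0 r.
(* The reversed product [b * a] need not vanish, but its square contains [a * b] in the middle. *)
have c2 : b * a * (b * a) = 0 by rewrite mulrA -(mulrA b) ab0 mulr0 mul0r.
have cC : central_elt (b * a) by apply: cR; exists 2; rewrite ?expr2.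
(* Cubing makes two copies of [b * a] appear between the outer [a] and [b], enough for [c2] to
   apply. *)
apply: cR; exists 3 => //.
(* The bracketing isolates [b * a * r], so that centrality can move the first [b * a] past [r], next
   to the second. *)
have -> : (a * r * b) ^+ 3 = a * r * (b * a * r) * (b * a) * r * b.
  by rewrite !exprS expr0 mulr1 !mulrA.
by rewrite (cC r) (mulrA _ r) -(mulrA _ (b * a) (b * a)) c2 mulr0 !mul0r.
Qed.
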